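(* Let $C=(C_\bullet,b,B)$ and $\bar C=(\bar C_\bullet,b,B)$ be parachain complexes of $k$-modules. Let $f:C_\bullet\to\bar C_\bullet$ and $g:\bar C_\bullet\to C_\bullet$ be $k$-linear maps commuting with $b$, and $\varphi:C_\bullet\to C_{\bullet+1}$ a $k$-linear map, such that $fg=1$ and $gf=1+b\varphi+\varphi b$. Suppose that $f,g,\varphi$ are $T$-compatible (commute with the $T$-operators) and that $\varphi$ is special ($f\varphi=0$, $\varphi g=0$, $\varphi^2=0$). Assume further that $$fBg=B\qquad\text{and}\qquad f(B\varphi)^jBg=0\ \text{ for } j\ge1 .$$ Let $f^\natural,g^\natural,\varphi^\natural$ be as defined in the context. Then: (i) $f^\natural:C^\natural_\bullet\to\bar C^\natural_\bullet$ and $g^\natural:\bar C^\natural_\bullet\to C^\natural_\bullet$ are $S$-maps and co-extensions of $f$ and $g$, respectively. (ii) $f^\natural g^\natural=1$ and $g^\natural f^\natural=1+(b+Bu^{-1})\varphi^\natural+\varphi^\natural(b+Bu^{-1})$. In particular, we obtain an $S$-deformation retract of $C^\natural$ to $\bar C^\natural$ and a $T$-deformation retract of $C^\sharp$ to $\bar C^\sharp$. (iii) The chain homotopy $\varphi^\natural$ is special, i.e. $f^\natural\varphi^\natural=0$, $\varphi^\natural g^\natural=0$, $(\varphi^\natural)^2=0$.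
   Context: $k$ is a unital ring, not assumed commutative; $k$-modules are left modules. A parachain complex $(C_\bullet,b,B)$ consists of $k$-modules $C_m$ ($m\ge0$) and $k$-linear maps $b:C_\bullet\to C_{\bullet-1}$, $B:C_\bullet\to C_{\bullet+1}$ with $b^2=0$, $B^2=0$, such that $T:=1-(bB+Bb)$ is an isomorphism. Put $C^\natural_m=\bigoplus_{p\ge0,\,2p\le m}C_{m-2p}u^p$, $u$ a formal variable; $u^{-1}(xu^p)=xu^{p-1}$ for $p\ge1$, $u^{-1}(xu^0)=0$; other operators act on coefficients. $C^\natural=(C^\natural_\bullet,d,S,T)$ with $d=b+Bu^{-1}$ and $S=u^{-1}$ is a para-$S$-module: $d^2=S(1-T)$ and $d,S,T$ commute pairwise. An $S$-map is a degree $0$ $k$-linear map commuting with $d,S,T$. A co-extension of a $T$-compatible map $f:C_\bullet\to\bar C_\bullet$ commuting with $b$ is an $S$-map $C^\natural_\bullet\to\bar C^\natural_\bullet$ of the form $f^{(0)}+f^{(1)}u^{-1}+f^{(2)}u^{-2}+\cdots$ with $f^{(j)}:C_\bullet\to\bar C_{\bullet+2j}$ and $f^{(0)}=f$. An $S$-deformation retract of $C^\natural$ to $\bar C^\natural$ is given by $S$-maps $F:C^\natural_\bullet\to\bar C^\natural_\bullet$, $G:\bar C^\natural_\bullet\to C^\natural_\bullet$ with $FG=1$ and $GF=1+dH+Hd$ for a $k$-linear $H$ of degree $+1$ commuting with $S$ and $T$. The periodic para-complex is $C^\sharp=(C_0^\sharp\oplus C_1^\sharp,b+B,T)$ with $C_i^\sharp=\prod_{q\ge0}C_{2q+i}$,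 $i=0,1$. A $T$-deformation retract of periodic para-complexes is a deformation retract (for the odd operators $b+B$) whose maps and homotopy commute with $T$. Definitions: $\varphi^\natural=\sum_{j\ge0}\varphi(B\varphi)^ju^{-j}:C^\natural_\bullet\to C^\natural_{\bullet+1}$; $f^\natural=f+\sum_{j\ge1}f(B\varphi)^ju^{-j}$; $g^\natural=g+\sum_{j\ge1}(\varphi B)^jg\,u^{-j}$. *)

(* Defs.v *)
From HB Require Import structures.
From mathcomp Require Import all_boot all_order all_algebra.
From mathcomp Require Import boolp.

Set Implicit Arguments.
Unset Strict Implicit.
Unset Printing Implicit Defensive.

Import GRing.Theory.
Local Open Scope ring_scope.

(* The modules in negative degrees vanish: [A \o- d] is the degree 0 operator
   A d for A of degree +1 and d of degree -1, hence is 0 in degree 0. *)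
Definition comp_low (k : pzRingType) (M N : nat -> lmodType k)
    (A : forall m, M m -> N m.+1) (d : forall m, M m.+1 -> M m) (m : nat) :
  M m -> N m :=
  match m with
  | 0 => fun _ => 0
  | m'.+1 => fun x => A m' (d m' x)
  end.

Arguments comp_low {k M N} A d m x.

Notation "A \o- d" := (comp_low (fun m => A m) (fun m => d m))
  (at level 50, format "A  \o-  d") : ring_scope.

(* T = 1 - (b B + B b) *)
Definition para_T (k : pzRingType) (M : nat -> lmodType k)
    (b : forall m, {linear M m.+1 -> M m})
    (B : forall m, {linear M m -> M m.+1}) (m : nat) (x : M m) : M m :=
  x - (b m (B m x) + (B \o- b) m x).

Record parachain (k : pzRingType) := Parachain {
  pc_mod :> nat -> lmodType k;
  pc_b : forall m, {linear pc_mod m.+1 -> pc_mod m};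
  pc_B : forall m, {linear pc_mod m -> pc_mod m.+1};
  pc_bb : forall m x, pc_b m (pc_b m.+1 x) = 0;
  pc_BB : forall m x, pc_B m.+1 (pc_B m x) = 0;
  pc_T_bij : forall m, bijective (@para_T k pc_mod pc_b pc_B m)
}.

Arguments pc_b {k} C m : rename.
Arguments pc_B {k} C m : rename.

Definition pc_T (k : pzRingType) (C : parachain k) (m : nat) : C m -> C m :=
  @para_T k C (pc_b C) (pc_B C) m.
Arguments pc_T {k} C m x.

(* C^nat_m = C_m u^0 (+) C_(m-2) u^1 (+) C_(m-4) u^2 (+) ..., written as
   C^nat_(m+2) = C_(m+2) u^0 (+) C^nat_m u so that no cast between degrees is
   needed: the pair (x, y) stands for x u^0 + y u. *)
Fixpoint natl (k : pzRingType) (M : nat -> lmodType k) (m : nat) : lmodType k :=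
  match m with
  | 0 => M 0%N
  | 1 => M 1%N
  | m'.+2 => (M m'.+2 * natl M m')%type
  end.

(* S = u^-1 on C^nat_(m+2); u^-1 vanishes on C^nat_0 and C^nat_1. *)
Definition nat_S (k : pzRingType) (M : nat -> lmodType k) (m : nat)
  (x : natl M m.+2) : natl M m := x.2.

(* the coefficient of u^0 *)
Definition coef0 (k : pzRingType) (M : nat -> lmodType k) (m : nat) :
  natl M m -> M m :=
  match m with
  | 0 => fun x => x
  | 1 => fun x => x
  | m'.+2 => fun x => x.1
  end.

(* Coefficientwise action A (x u^p) = (A x) u^p of operators A of degree 0, +1
   and -1. *)
Fixpoint ulift0 (k : pzRingType) (M N : nat -> lmodType k)
    (A : forall m, M m -> N m) (m : nat) : natl M m -> natl N m :=
  match m with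
  | 0 => A 0%N
  | 1 => A 1%N
  | m'.+2 => fun x => (A m'.+2 x.1, ulift0 A x.2)
  end.

Fixpoint uliftp (k : pzRingType) (M N : nat -> lmodType k)
    (A : forall m, M m -> N m.+1) (m : nat) : natl M m -> natl N m.+1 :=
  match m with
  | 0 => A 0%N
  | 1 => fun x => (A 1%N x, 0)
  | m'.+2 => fun x => (A m'.+2 x.1, uliftp A x.2)
  end.

Fixpoint uliftm (k : pzRingType) (M N : nat -> lmodType k)
    (A : forall m, M m.+1 -> N m) (m : nat) : natl M m.+1 -> natl N m :=
  match m with
  | 0 => A 0%N
  | 1 => fun x => A 1%N x.1
  | m'.+2 => fun x => (A m'.+2 x.1, uliftm A x.2)
  end.

(* the coefficient of u^0 in A (u^-j x), for an operator A of degree 2j *)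
Fixpoint coef_op (k : pzRingType) (M : nat -> lmodType k) (j : nat) :
    forall (N : nat -> lmodType k), (forall n, M n -> N (j.*2 + n)%N) ->
    forall m, natl M m -> N m :=
  match j with
  | 0 => fun N A m x => A m (coef0 x)
  | j'.+1 => fun N A m =>
      match m with
      | 0 => fun _ => 0
      | 1 => fun _ => 0
      | m'.+2 => fun x => @coef_op k M j' (fun n => N n.+2) A m' x.2
      end
  end.

(* the inclusion x |-> x u^p of C_m in C^nat_(2p+m) *)
Definition mono0 (k : pzRingType) (M : nat -> lmodType k) (m : nat) :
  M m -> natl M m :=
  match m with
  | 0 => fun x => x
  | 1 => fun x => x
  | m'.+2 => fun x => (x, 0)
  end.

Fixpoint mono (k : pzRingType) (M : nat -> lmodType k) (p m : nat) (x : M m) :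
  natl M (p.*2 + m) :=
  match p with
  | 0 => mono0 x
  | p'.+1 => (0, mono p' x)
  end.

Lemma coef_op_mono (k : pzRingType) (M N : nat -> lmodType k) (j m : nat)
    (A : forall n, M n -> N (j.*2 + n)%N) (x : M m) :
  coef_op A (mono j x) = A m x.
Proof.
elim: j N A => [|j IH] N A /=; first by case: m x => [|[|m]] x.
exact: (IH (fun n => N n.+2) A).
Qed.

(* The degree 0 operator A u^-j, for an operator A of degree 2j:
   x u^p |-> (A x) u^(p-j) if j <= p and 0 otherwise. *)
Fixpoint op_u (k : pzRingType) (M N : nat -> lmodType k) (j : nat)
    (A : forall n, M n -> N (j.*2 + n)%N) (m : nat) : natl M m -> natl N m :=
  match m with
  | 0 => fun x => @coef_op k M j N A 0%N x
  | 1 => fun x => @coef_op k M j N A 1%N x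
  | m'.+2 => fun x => (@coef_op k M j N A m'.+2 x, op_u A x.2)
  end.

(* sum_(j >= 0) A_j u^-j with A_j of degree 2j; on C^nat_m the terms with
   2j > m vanish. *)
Definition u_series (k : pzRingType) (M N : nat -> lmodType k)
    (A : forall j n, M n -> N (j.*2 + n)%N) (m : nat) (x : natl M m) :
  natl N m := \sum_(j < (m./2).+1) op_u (A j) x.

(* d = b + B u^-1 *)
Definition nat_d (k : pzRingType) (C : parachain k) (m : nat) :
  natl C m.+1 -> natl C m :=
  match m with
  | 0 => fun x => uliftm (fun n => pc_b C n) x
  | m'.+1 => fun x =>
      uliftm (fun n => pc_b C n) x + uliftp (fun n => pc_B C n) (nat_S x)
  end.
Arguments nat_d {k} C m x.

Definition nat_T (k : pzRingType) (C : parachain k) (m : nat) :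
  natl C m -> natl C m := ulift0 (pc_T C) (m := m).
Arguments nat_T {k} C m x.

Definition S_map (k : pzRingType) (C D : parachain k)
    (F : forall m, natl C m -> natl D m) : Prop :=
  [/\ forall m, linear (F m),
      forall m x, F m (nat_d C m x) = nat_d D m (F m.+1 x),
      forall m x, F m (nat_S x) = nat_S (F m.+2 x)
    & forall m x, F m (nat_T C m x) = nat_T D m (F m x)].

Definition coextension (k : pzRingType) (C D : parachain k)
    (f : forall m, {linear C m -> D m})
    (F : forall m, natl C m -> natl D m) : Prop :=
  S_map F /\
  exists A : forall j n, {linear C n -> D (j.*2 + n)%N},
    (forall n x, A 0%N n x = f n x) /\
    (forall m x, F m x = u_series (fun j n => A j n) x).

(* As S = 0 on C^nat_1, commutation of H with S means S H = 0 there; the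
   condition is void on C^nat_0. *)
Definition S_deformation_retract (k : pzRingType) (C D : parachain k)
    (F : forall m, natl C m -> natl D m) (G : forall m, natl D m -> natl C m)
    (H : forall m, natl C m -> natl C m.+1) : Prop :=
  [/\ S_map F, S_map G,
      [/\ forall m, linear (H m),
          forall m x, H m (nat_S x) = nat_S (H m.+2 x),
          forall x, nat_S (H 1%N x) = 0
        & forall m x, H m (nat_T C m x) = nat_T C m.+1 (H m x)],
      forall m x, F m (G m x) = x
    & forall m x,
        G m (F m x) = x + nat_d C m (H m x) + (H \o- nat_d C) m x].

(* product of a sequence of modules *)
Definition seqprod (k : pzRingType) (M : nat -> lmodType k) : Type :=
  forall q, M q.

HB.instance Definition _ (k : pzRingType) (M : nat -> lmodType k) :=
  Choice.copy (seqprod M) (forall q, M q).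

Fact seqprod_addA (k : pzRingType) (M : nat -> lmodType k) :
  associative (fun x y : seqprod M => (fun q => x q + y q) : seqprod M).
Proof. by move=> x y z; apply: functional_extensionality_dep => q; rewrite addrA. Qed.

Fact seqprod_addC (k : pzRingType) (M : nat -> lmodType k) :
  commutative (fun x y : seqprod M => (fun q => x q + y q) : seqprod M).
Proof. by move=> x y; apply: functional_extensionality_dep => q; rewrite addrC. Qed.

Fact seqprod_add0 (k : pzRingType) (M : nat -> lmodType k) :
  left_id ((fun q => 0) : seqprod M)
    (fun x y : seqprod M => (fun q => x q + y q) : seqprod M).
Proof. by move=> x; apply: functional_extensionality_dep => q; rewrite add0r. Qed.

Fact seqprod_addN (k : pzRingType) (M : nat -> lmodType k) :
  left_inverse ((fun q => 0) : seqprod M)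
    (fun x : seqprod M => (fun q => - x q) : seqprod M)
    (fun x y : seqprod M => (fun q => x q + y q) : seqprod M).
Proof. by move=> x; apply: functional_extensionality_dep => q; rewrite addNr. Qed.

HB.instance Definition _ (k : pzRingType) (M : nat -> lmodType k) :=
  GRing.isZmodule.Build (seqprod M)
    (@seqprod_addA k M) (@seqprod_addC k M) (@seqprod_add0 k M)
    (@seqprod_addN k M).

Definition seqprod_scale (k : pzRingType) (M : nat -> lmodType k) (a : k)
  (x : seqprod M) : seqprod M := fun q => a *: x q.

Fact seqprod_scaleA (k : pzRingType) (M : nat -> lmodType k) (a b : k)
  (x : seqprod M) :
  seqprod_scale a (seqprod_scale b x) = seqprod_scale (a * b) x.
Proof. by apply: functional_extensionality_dep => q; rewrite /seqprod_scale scalerA. Qed.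

Fact seqprod_scale1 (k : pzRingType) (M : nat -> lmodType k) :
  left_id 1 (@seqprod_scale k M).
Proof. by move=> x; apply: functional_extensionality_dep => q; rewrite /seqprod_scale scale1r. Qed.

Fact seqprod_scaleDr (k : pzRingType) (M : nat -> lmodType k) :
  right_distributive (@seqprod_scale k M) +%R.
Proof. by move=> a x y; apply: functional_extensionality_dep => q; exact: scalerDr. Qed.

Fact seqprod_scaleDl (k : pzRingType) (M : nat -> lmodType k) (x : seqprod M) :
  {morph (@seqprod_scale k M)^~ x : a b / a + b}.
Proof. by move=> a b; apply: functional_extensionality_dep => q; exact: scalerDl. Qed.

HB.instance Definition _ (k : pzRingType) (M : nat -> lmodType k) :=
  GRing.Zmodule_isLmodule.Build k (seqprod M)
    (@seqprod_scaleA k M) (@seqprod_scale1 k M) (@seqprod_scaleDr k M)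
    (@seqprod_scaleDl k M).

(* C^sharp = C^sharp_0 (+) C^sharp_1 with C^sharp_i = prod_q C_(2q+i) *)
Definition sharp0 (k : pzRingType) (M : nat -> lmodType k) : lmodType k :=
  seqprod (fun q => M q.*2).
Definition sharp1 (k : pzRingType) (M : nat -> lmodType k) : lmodType k :=
  seqprod (fun q => M q.*2.+1).
Definition sharp (k : pzRingType) (M : nat -> lmodType k) : lmodType k :=
  (sharp0 M * sharp1 M)%type.

(* the operator b + B *)
Definition sharp_d01 (k : pzRingType) (C : parachain k) (x : sharp0 C) :
  sharp1 C := fun q => pc_b C q.*2.+1 (x q.+1) + pc_B C q.*2 (x q).

Definition sharp_d10 (k : pzRingType) (C : parachain k) (y : sharp1 C) :
  sharp0 C := fun q =>
  match q with
  | 0 => pc_b C 0%N (y 0%N)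
  | q'.+1 => pc_b C q'.+1.*2 (y q'.+1) + pc_B C q'.*2.+1 (y q')
  end.

Definition sharp_d (k : pzRingType) (C : parachain k) (z : sharp C) : sharp C :=
  (sharp_d10 z.2, sharp_d01 z.1).

Definition sharp_T (k : pzRingType) (C : parachain k) (z : sharp C) : sharp C :=
  ((fun q => pc_T C q.*2 (z.1 q)), (fun q => pc_T C q.*2.+1 (z.2 q))).

Definition even_op (k : pzRingType) (M N : nat -> lmodType k)
    (F : sharp M -> sharp N) : Prop :=
  (forall x, (F (x, 0)).2 = 0) /\ (forall y, (F (0, y)).1 = 0).

Definition odd_op (k : pzRingType) (M N : nat -> lmodType k)
    (F : sharp M -> sharp N) : Prop :=
  (forall x, (F (x, 0)).1 = 0) /\ (forall y, (F (0, y)).2 = 0).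

(* maps of periodic para-complexes *)
Definition T_map (k : pzRingType) (C D : parachain k)
    (F : sharp C -> sharp D) : Prop :=
  [/\ linear F, even_op F,
      forall z, F (sharp_d z) = sharp_d (F z)
    & forall z, F (sharp_T z) = sharp_T (F z)].

Definition T_deformation_retract (k : pzRingType) (C D : parachain k)
    (F : sharp C -> sharp D) (G : sharp D -> sharp C)
    (H : sharp C -> sharp C) : Prop :=
  [/\ T_map F, T_map G,
      [/\ linear H, odd_op H & forall z, H (sharp_T z) = sharp_T (H z)],
      forall z, F (G z) = z
    & forall z, G (F z) = z + sharp_d (H z) + H (sharp_d z)].

(* C^sharp_i is the inverse limit of the C^nat_(2q+i) along S, with projections
   (x_q)_q |-> sum_p x_(q-p) u^p. *)
Fixpoint trunc0 (k : pzRingType) (M : nat -> lmodType k) (x : sharp0 M)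
    (q : nat) : natl M q.*2 :=
  match q with
  | 0 => x 0%N
  | q'.+1 => (x q'.+1, trunc0 x q')
  end.

Fixpoint trunc1 (k : pzRingType) (M : nat -> lmodType k) (y : sharp1 M)
    (q : nat) : natl M q.*2.+1 :=
  match q with
  | 0 => y 0%N
  | q'.+1 => (y q'.+1, trunc1 y q')
  end.

(* The maps between periodic complexes induced in the limit by maps commuting
   with S, of degree 0 and of degree +1: u is set to 1, i.e. sum_j A_j u^-j
   induces sum_j A_j. *)
Definition sharp_map (k : pzRingType) (M N : nat -> lmodType k)
    (F : forall m, natl M m -> natl N m) (z : sharp M) : sharp N :=
  ((fun q => coef0 (F q.*2 (trunc0 z.1 q))),
   (fun q => coef0 (F q.*2.+1 (trunc1 z.2 q)))).

Definition sharp_map1 (k : pzRingType) (M N : nat -> lmodType k)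
    (H : forall m, natl M m -> natl N m.+1) (z : sharp M) : sharp N :=
  ((fun q => match q return N q.*2 with
             | 0 => 0
             | q'.+1 => coef0 (H q'.*2.+1 (trunc1 z.2 q'))
             end),
   (fun q => coef0 (H q.*2 (trunc0 z.1 q)))).

(* (B phi)^j and (phi B)^j *)
Fixpoint pow_Bphi (k : pzRingType) (C : parachain k)
    (phi : forall m, {linear C m -> C m.+1}) (j n : nat) (x : C n) :
  C (j.*2 + n)%N :=
  match j with
  | 0 => x
  | j'.+1 => pc_B C _ (phi _ (pow_Bphi phi j' x))
  end.

Fixpoint pow_phiB (k : pzRingType) (C : parachain k)
    (phi : forall m, {linear C m -> C m.+1}) (j n : nat) (x : C n) :
  C (j.*2 + n)%N :=
  match j with
  | 0 => x
  | j'.+1 => phi _ (pc_B C _ (pow_phiB phi j' x))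
  end.

(* f^nat, g^nat; the term j = 0 is f, resp. g. *)
Definition f_nat (k : pzRingType) (C D : parachain k)
    (f : forall m, {linear C m -> D m})
    (phi : forall m, {linear C m -> C m.+1}) (m : nat) :
  natl C m -> natl D m :=
  @u_series k C D (fun j n x => f _ (pow_Bphi phi j x)) m.

Definition g_nat (k : pzRingType) (C D : parachain k)
    (g : forall m, {linear D m -> C m})
    (phi : forall m, {linear C m -> C m.+1}) (m : nat) :
  natl D m -> natl C m :=
  @u_series k D C (fun j n x => pow_phiB phi j (g n x)) m.

Definition phi_nat (k : pzRingType) (C : parachain k)
    (phi : forall m, {linear C m -> C m.+1}) (m : nat) (x : natl C m) :
  natl C m.+1 :=
  \sum_(j < (m./2).+1)
     uliftp (fun n => phi n) (op_u (fun n (y : C n) => pow_Bphi phi j y) x).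

(* Main.v *)
From HB Require Import structures.
From mathcomp Require Import all_boot all_order all_algebra.
From mathcomp Require Import boolp.
Require Import Defs.
Local Open Scope ring_scope.

(** This is a homological perturbation argument. Write [delta = B u^-1] and view
[d = b + delta] as a perturbation of [b] on C^nat. Because [delta phi] and
[phi delta] lower the power of u, the geometric series
[X = sum_j (delta phi)^j] and [Y = sum_j (phi delta)^j] are finite on each
element and invert [1 - delta phi] and [1 - phi delta]; moreover
[f^nat = f X], [g^nat = Y g] and [phi^nat = phi X]. The hypotheses on [f B g]
and [f (B phi)^j B g] say that [f X delta g], the perturbation induced on D^nat,
is the operator [B u^-1] of D.

The classical perturbation lemma uses d^2 = 0. Here b^2 = delta^2 = 0 but
[b delta + delta b = R] with [R = S (1 - T)]. The operator R commutes with [phi]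
and with [X], so in every computation it ends up between maps among
[f, phi, g] whose composite vanishes since [phi] is special; this is why the
conclusions survive ([perturbation_lemma]).

To compute with operators of degrees 0, 1 and -1 without a separate treatment of
the lowest degree, the lemma is applied to the product of all the C^nat_m:
there an operator of degree -1 drops the component of degree 0, an operator of
degree +1 inserts 0, and [comp_low] becomes the plain composite
([deg_up_down]). Commutation of [X] and [Y] with S and T needs no computation
either, since they are two-sided inverses of operators that commute with S and T
([geometric_inverse_comm]).

Finally C^sharp is the inverse limit of the C^nat_m along S, so every
S-deformation retract induces a T-deformation retract of the periodic complexes
([sharp_retract]). *)

Set Implicit Arguments.
Unset Strict Implicit.
Unset Printing Implicit Defensive.
Import GRing.Theory.

Definition mkLin (k : pzRingType) (U V : lmodType k) (h : U -> V)
    (lin_h : linear h) : {linear U -> V} :=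
  HB.pack h (GRing.isLinear.Build k U V *:%R h lin_h).

(** * Inverses of 1 - N *)

Section GeometricInverse.

Variables (k : pzRingType) (E : lmodType k).

(** [X] is a two-sided inverse of [1 - N]; the form of a recursion for the
geometric series keeps subtraction out of the computations. *)
Definition geometric_inverse (N X : E -> E) : Prop :=
  (forall x, X x = x + X (N x)) /\ (forall x, X x = x + N (X x)).

(** [X R = X R (1 - N) X = X (1 - N) R X = R X]. *)
Lemma geometric_inverse_comm (N R X : {linear E -> E}) :
    geometric_inverse N X -> (forall x, R (N x) = N (R x)) ->
  forall x, R (X x) = X (R x).
Proof.
move=> [Xl Xr] RN x.
apply: (addIr (X (N (R (X x))))).
by rewrite -Xl -RN -!linearD -Xr.
Qed.

(** [p (1 - q p) = (1 - p q) p]; invert both sides. *)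
Lemma geometric_inverse_push (p q X Y : {linear E -> E}) :
    geometric_inverse (q \o p) X -> geometric_inverse (p \o q) Y ->
  forall x, p (X x) = Y (p x).
Proof.
move=> [_ Xr] [Yl _] x.
apply: (addIr (Y (p (q (p (X x)))))).
by rewrite -[LHS]Yl -!linearD -Xr.
Qed.

End GeometricInverse.

(** * Perturbation of a special deformation retract with curvature *)

Section Perturbation.

Variables (k : pzRingType) (E F : lmodType k).
Variables (b B phi R X Y : {linear E -> E}) (bF BF : {linear F -> F}).
Variables (f : {linear E -> F}) (g : {linear F -> E}).

Hypothesis f_b : forall x, f (b x) = bF (f x).
Hypothesis g_b : forall x, g (bF x) = b (g x).
Hypothesis fg : forall x, f (g x) = x.
Hypothesis gf : forall x, g (f x) = x + b (phi x) + phi (b x).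
Hypothesis f_phi : forall x, f (phi x) = 0.
Hypothesis phi_g : forall x, phi (g x) = 0.
Hypothesis phi_phi : forall x, phi (phi x) = 0.
Hypothesis BB : forall x, B (B x) = 0.
Hypothesis bB : forall x, b (B x) + B (b x) = R x.
Hypothesis R_phi : forall x, R (phi x) = phi (R x).
Hypothesis X_inv : geometric_inverse (B \o phi) X.
Hypothesis Y_inv : geometric_inverse (phi \o B) Y.
Hypothesis fXBg : forall x, f (X (B (g x))) = BF x.

Lemma X_phi x : X (phi x) = phi x.
Proof. by rewrite X_inv.1 /= phi_phi !linear0 addr0. Qed.

Lemma f_Y x : f (Y x) = f x.
Proof. by rewrite Y_inv.2 /= linearD /= f_phi addr0. Qed.

Lemma phi_Yg x : phi (Y (g x)) = 0.
Proof. by rewrite Y_inv.2 /= linearD /= phi_phi phi_g addr0. Qed.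

Lemma phi_X x : phi (X x) = Y (phi x).
Proof. exact: (geometric_inverse_push X_inv Y_inv). Qed.

Lemma B_Y x : B (Y x) = X (B x).
Proof. exact: (geometric_inverse_push Y_inv X_inv). Qed.

(** With [x = y - B phi y], replace [b B phi y] by [R phi y - B b phi y] and
then [b phi y] by [g f y - y - phi b y]. Applying [f X], respectively [Y phi],
gives [perturbed_f_d] and [perturbed_gf]. *)
Lemma perturbed_d x (y := X x) :
  b x + B x + B (phi (b y)) + phi (R y) = b y + B (g (f y)).
Proof.
have yE : y = x + B (phi y) by exact: X_inv.2.
rewrite gf !(linearD B) /= {3 4}yE -R_phi -bB !linearD /= BB addr0.
by rewrite [LHS](AC ((2*1)*2) ((1*4)*((2*5)*3))).
Qed.

Lemma perturbed_fg x : f (X (Y (g x))) = x.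
Proof. by rewrite X_inv.1 /= phi_Yg !linear0 addr0 f_Y fg. Qed.

(** Apply [f X] to [perturbed_d]: [X] maps [b y - B phi b y] to [b y], and the
curvature term becomes [f X phi R y = f phi R y = 0]. *)
Lemma perturbed_f_d x : f (X (b x + B x)) = bF (f (X x)) + BF (f (X x)).
Proof.
have /(congr1 (fun z => f (X z))) := perturbed_d x.
rewrite -R_phi -bB; set y := X x.
rewrite !(linearD X) !(linearD f) /= fXBg [in RHS]X_inv.1 /= linearD /= f_b.
have -> : f (X (b (B (phi y)))) + f (X (B (b (phi y)))) = 0.
  by rewrite -!linearD bB R_phi /= X_phi f_phi.
rewrite addr0 => /eqP.
by rewrite (addrAC (bF _)) (inj_eq (addIr _)) => /eqP ->.
Qed.

(** It suffices to apply [1 - phi B] to both sides, and the curvature term is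
[phi R y = R phi y = 0] since [y = Y g x] is killed by [phi]. *)
Lemma perturbed_g_d x : Y (g (bF x + BF x)) = b (Y (g x)) + B (Y (g x)).
Proof.
set y := Y (g x); have yE : y = g x + phi (B y) by exact: Y_inv.2.
have phiR : phi (b (B y)) + phi (B (b y)) = 0.
  by rewrite -linearD bB -R_phi phi_Yg linear0.
have gBF : g (BF x) = B y + b (phi (B y)) + phi (b (B y)).
  by rewrite -gf B_Y fXBg.
apply: (addIr (Y (phi (B (b y + B y))))).
rewrite -[RHS]Y_inv.1 -linearD; congr (Y _).
have bE : b y = b (g x) + b (phi (B y)) by rewrite {1}yE linearD.
rewrite (linearD B) /= BB addr0 linearD /= g_b gBF [in RHS]bE.
by rewrite [LHS](AC ((1*3)*1) (((1*3)*2)*(4*5))) /= phiR addr0.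
Qed.

(** As [phi X = Y phi], both sides can be compared after applying [1 - phi B];
[phi] kills the curvature term of [perturbed_d] because [phi^2 = 0]. *)
Lemma perturbed_gf x :
  Y (g (f (X x))) = x + (b (phi (X x)) + B (phi (X x))) + phi (X (b x + B x)).
Proof.
have xE : x + B (phi (X x)) = X x by rewrite -X_inv.2.
rewrite [phi (X (b x + B x))]phi_X; set y := X x in xE *.
have dE : phi (b x + B x) + phi (B (phi (b y))) =
    phi (b y) + phi (B (g (f y))).
  rewrite -!linearD -perturbed_d -/y.
  by rewrite (linearD _ _ (phi (R y))) /= phi_phi addr0.
apply: (addIr (Y (phi (B (phi (b y)))))).
rewrite -[RHS]addrA -[in RHS](linearD Y) dE (linearD Y) /=.
rewrite [in LHS]Y_inv.1 [in RHS]Y_inv.1 /= [X in X + _ + _ = _]gf.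
rewrite -[X in X + _ + _ + _ + _ = _]xE.
by rewrite [LHS](AC (((2*1)*1)*1*1) ((1*(3*2))*((4*6)*5))).
Qed.

(** The perturbation lemma for [b + B] when [b B + B b = R] commutes with [phi]
instead of being 0. *)
Theorem perturbation_lemma :
  [/\ forall x, f (X (b x + B x)) = bF (f (X x)) + BF (f (X x)),
      forall x, Y (g (bF x + BF x)) = b (Y (g x)) + B (Y (g x)),
      forall x, f (X (Y (g x))) = x
    & forall x, Y (g (f (X x))) =
        x + (b (phi (X x)) + B (phi (X x))) + phi (X (b x + B x))] /\
  [/\ forall x, f (X (phi (X x))) = 0,
      forall x, phi (X (Y (g x))) = 0
    & forall x, phi (X (phi (X x))) = 0].
Proof.
do 2?split.
- exact: perturbed_f_d.
- exact: perturbed_g_d.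
- exact: perturbed_fg.
- exact: perturbed_gf.
- by move=> x; rewrite X_phi f_phi.
- by move=> x; rewrite phi_X phi_Yg linear0.
- by move=> x; rewrite X_phi phi_phi.
Qed.

End Perturbation.

(** * Coefficientwise operators on C^nat *)

(** The induction that follows the recursion of [natl]. *)
Lemma two_step_ind (P : nat -> Prop) :
  P 0%N -> P 1%N -> (forall m, P m -> P m.+2) -> forall m, P m.
Proof.
move=> P0 P1 PS m.
by suff [] : P m /\ P m.+1 by []; elim: m => [|m [IH1 IH2]]; split; auto.
Qed.

Section CoefficientwiseOperators.

Variables (k : pzRingType) (M N : nat -> lmodType k).

Lemma ulift0_linear (A : forall m, {linear M m -> N m}) m :
  linear (ulift0 (fun n => A n) (m := m)).
Proof.
elim/two_step_ind: m => [||m IH] a x y /=; rewrite ?linearP //.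
by rewrite [in LHS]IH.
Qed.

Lemma uliftp_linear (A : forall m, {linear M m -> N m.+1}) m :
  linear (uliftp (fun n => A n) (m := m)).
Proof.
elim/two_step_ind: m => [||m IH] a x y /=; rewrite ?linearP //.
  by apply: injective_projections; rewrite /= ?linearP ?scaler0 ?addr0.
by rewrite [in LHS]IH.
Qed.

Lemma uliftm_linear (A : forall m, {linear M m.+1 -> N m}) m :
  linear (uliftm (fun n => A n) (m := m)).
Proof.
elim/two_step_ind: m => [||m IH] a x y /=; rewrite ?linearP //.
by rewrite [in LHS]IH.
Qed.

Lemma nat_S_linear m : linear (@nat_S k M m).
Proof. by []. Qed.

Lemma coef0_linear m : linear (@coef0 k M m).
Proof. by case: m => [|[|m]]. Qed.

End CoefficientwiseOperators.

Lemma coef_op_linear (k : pzRingType) (M N : nat -> lmodType k) j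
    (A : forall n, {linear M n -> N (j.*2 + n)%N}) m :
  linear (@coef_op k M j N (fun n => A n) m).
Proof.
elim: j N A m => [|j IH] N A m a x y /=; first by rewrite coef0_linear linearP.
case: m x y => [|[|m]] x y; rewrite ?scaler0 ?addr0 //.
exact: (IH (fun n => N n.+2)).
Qed.

Lemma op_u_linear (k : pzRingType) (M N : nat -> lmodType k) j
    (A : forall n, {linear M n -> N (j.*2 + n)%N}) m :
  linear (@op_u k M N j (fun n => A n) m).
Proof.
elim/two_step_ind: m => [||m IH] a x y /=; rewrite ?coef_op_linear //.
by rewrite [in LHS]IH.
Qed.

Lemma u_series_linear (k : pzRingType) (M N : nat -> lmodType k)
    (A : forall j n, {linear M n -> N (j.*2 + n)%N}) m :
  linear (@u_series k M N (fun j n => A j n) m).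
Proof.
move=> a x y; rewrite /u_series scaler_sumr -big_split /=.
by apply: eq_bigr => j _; rewrite op_u_linear.
Qed.

(** * Operators of the form A u^-j *)

Lemma coef_op_eq0 (k : pzRingType) (M N : nat -> lmodType k) j
    (A : forall n, M n -> N (j.*2 + n)%N) m (x : natl M m) :
  (m./2 < j)%N -> coef_op A x = 0.
Proof.
elim: j N A m x => [|j IH] N A m x //.
by case: m x => [|[|m]] x //= lt_mj; apply: IH.
Qed.

Lemma op_u_eq0 (k : pzRingType) (M N : nat -> lmodType k) j
    (A : forall n, M n -> N (j.*2 + n)%N) m (x : natl M m) :
  (m./2 < j)%N -> op_u A x = 0.
Proof.
elim/two_step_ind: m x => [||m IH] x lt_mj; rewrite /= ?coef_op_eq0 //.
by rewrite IH //; apply: ltn_trans lt_mj.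
Qed.

Lemma coef_op_postcomp (k : pzRingType) (M N N' : nat -> lmodType k) j
    (A : forall n, M n -> N (j.*2 + n)%N) (h : forall n, {linear N n -> N' n})
    m (x : natl M m) :
  coef_op (fun n y => h _ (A n y)) x = h m (coef_op A x).
Proof.
elim: j N N' A h m x => [|j IH] N N' A h m x //.
case: m x => [|[|m]] x /=; rewrite ?linear0 //.
exact: (IH (fun n => N n.+2) (fun n => N' n.+2) A (fun n => h n.+2)).
Qed.

Lemma ulift0_op_u (k : pzRingType) (M N N' : nat -> lmodType k) j
    (A : forall n, M n -> N (j.*2 + n)%N) (h : forall n, {linear N n -> N' n})
    m (x : natl M m) :
  ulift0 (fun n => h n) (op_u A x) = op_u (fun n y => h _ (A n y)) x.
Proof.
elim/two_step_ind: m x => [||m IH] x /=; rewrite ?coef_op_postcomp //.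
by rewrite IH.
Qed.

Lemma coef_op_precomp (k : pzRingType) (M M' N : nat -> lmodType k) j
    (A : forall n, M n -> N (j.*2 + n)%N) (h : forall n, {linear M' n -> M n})
    m (x : natl M' m) :
  coef_op A (ulift0 (fun n => h n) x) = coef_op (fun n y => A n (h n y)) x.
Proof.
elim: j N A m x => [|j IH] N A m x /=; first by case: m x => [|[|m]] x.
by case: m x => [|[|m]] x //; rewrite -IH.
Qed.

Lemma op_u_ulift0 (k : pzRingType) (M M' N : nat -> lmodType k) j
    (A : forall n, M n -> N (j.*2 + n)%N) (h : forall n, {linear M' n -> M n})
    m (x : natl M' m) :
  op_u A (ulift0 (fun n => h n) x) = op_u (fun n y => A n (h n y)) x.
Proof.
elim/two_step_ind: m x => [||m IH] x /=; rewrite ?IH //.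
- exact: (@coef_op_precomp k M M' N j A h 0).
- exact: (@coef_op_precomp k M M' N j A h 1).
- by congr pair; exact: (@coef_op_precomp k M M' N j A h m.+2).
Qed.

(** The coefficients of [uliftp h x] are values of [h], except possibly the last
one, which is 0 when it has degree 0; so only the values of [A] on the image of
[h] matter. *)
Lemma coef_op_uliftp_eq0 (k : pzRingType) (L M N : nat -> lmodType k) j
    (A : forall n, {linear M n -> N (j.*2 + n)%N})
    (h : forall n, {linear L n -> M n.+1}) m (x : natl L m) :
  (forall n y, A n.+1 (h n y) = 0) ->
  coef_op (fun n => A n) (uliftp (fun n => h n) x) = 0.
Proof.
move=> Ah0; elim: j N A m x Ah0 => [|j IH] N A m x Ah0.
  by case: m x => [|[|m]] x /=; rewrite Ah0.
case: m x => [|[|m]] x //=.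
  exact: (linear0 (mkLin (coef_op_linear (N := fun n => N n.+2) A (m := 0)))).
exact: (IH (fun n => N n.+2) A).
Qed.

Lemma op_u_uliftp_eq0 (k : pzRingType) (L M N : nat -> lmodType k) j
    (A : forall n, {linear M n -> N (j.*2 + n)%N})
    (h : forall n, {linear L n -> M n.+1}) m (x : natl L m) :
  (forall n y, A n.+1 (h n y) = 0) ->
  op_u (fun n => A n) (uliftp (fun n => h n) x) = 0.
Proof.
move=> Ah0; elim/two_step_ind: m x => [||m IH] x.
- exact: (coef_op_uliftp_eq0 (m := 0) x Ah0).
- rewrite /= (coef_op_uliftp_eq0 (m := 1) x Ah0); congr pair.
  exact: (linear0 (mkLin (coef_op_linear A (m := 0)))).
- apply: injective_projections; last exact: IH.
  exact: (coef_op_uliftp_eq0 (m := m.+2) x Ah0).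
Qed.

(** Composition with [P Q u^-1] on the left; this identifies the operators
[(P Q)^j u^-j] with the powers of [P Q u^-1]. *)
Lemma op_u_step (k : pzRingType) (M : nat -> lmodType k)
    (P Q : forall n, {linear M n -> M n.+1})
    (A : forall j n, M n -> M (j.*2 + n)%N) j m (x : natl M m.+2) :
  (forall n y, A j.+1 n y = P _ (Q _ (A j n y))) ->
  op_u (A j.+1) x =
    uliftp (fun n => P n) (uliftp (fun n => Q n) (op_u (A j) (nat_S x))).
Proof.
move=> AS.
have coefE n (y : natl M n) :
    @coef_op k M j (fun i => M i.+2) (A j.+1) n y = P _ (Q _ (coef_op (A j) y)).
  rewrite -[RHS](@coef_op_postcomp k M M (fun i => M i.+2) j (A j)
    (fun i => P i.+1 \o Q i)).
  congr (@coef_op k M j (fun i => M i.+2) _ n y).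
  apply: functional_extensionality_dep => i.
  by apply: functional_extensionality_dep => z; exact: AS.
elim/two_step_ind: m x => [||m IH] x.
- by apply: injective_projections; first exact: coefE.
- by apply: injective_projections; [exact: coefE | rewrite /= linear0].
- by apply: injective_projections; [exact: coefE | exact: IH].
Qed.

(** * Relations between coefficientwise operators *)

Section Relations.

Variables (k : pzRingType) (M N : nat -> lmodType k).

Lemma uliftp_uliftp_eq0 (P Q : forall n, {linear M n -> M n.+1}) m
    (x : natl M m) :
  (forall n y, P n.+1 (Q n y) = 0) ->
  uliftp (fun n => P n) (uliftp (fun n => Q n) x) = 0.
Proof.
move=> PQ0; elim/two_step_ind: m x => [||m IH] x.
- by apply: injective_projections; first exact: PQ0.
- by apply: injective_projections; [exact: PQ0 | exact: linear0].
- by apply: injective_projections; [exact: PQ0 | exact: IH].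
Qed.

Lemma ulift0_uliftp_eq0 (f : forall n, {linear M n -> N n})
    (Q : forall n, {linear M n -> M n.+1}) m (x : natl M m) :
  (forall n y, f n.+1 (Q n y) = 0) ->
  ulift0 (fun n => f n) (uliftp (fun n => Q n) x) = 0.
Proof.
move=> PQ0; elim/two_step_ind: m x => [||m IH] x; first exact: PQ0.
  by apply: injective_projections; [exact: PQ0 | exact: linear0].
by apply: injective_projections; [exact: PQ0 | exact: IH].
Qed.

Lemma uliftp_ulift0 (L : nat -> lmodType k)
    (Q : forall n, {linear M n -> N n.+1})
    (g : forall n, {linear L n -> M n}) m (x : natl L m) :
  uliftp (fun n => Q n) (ulift0 (fun n => g n) x) =
    uliftp (fun n y => Q n (g n y)) x.
Proof.
by elim/two_step_ind: m x => [||m IH] x //; apply: injective_projections;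
  last exact: IH.
Qed.

Lemma ulift0_uliftp (f : forall n, {linear M n -> M n})
    (P : forall n, {linear M n -> M n.+1}) m (x : natl M m) :
  (forall n y, f n.+1 (P n y) = P n (f n y)) ->
  ulift0 (fun n => f n) (uliftp (fun n => P n) x) =
    uliftp (fun n => P n) (ulift0 (fun n => f n) x).
Proof.
move=> fP; elim/two_step_ind: m x => [||m IH] x; first exact: fP.
  by apply: injective_projections; [exact: fP | exact: linear0].
by apply: injective_projections; [exact: fP | exact: IH].
Qed.

Lemma ulift0_uliftm (f : forall n, {linear M n -> N n})
    (d : forall n, {linear M n.+1 -> M n})
    (e : forall n, {linear N n.+1 -> N n}) m (x : natl M m.+1) :
  (forall n y, f n (d n y) = e n (f n.+1 y)) ->
  ulift0 (fun n => f n) (uliftm (fun n => d n) x) =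
    uliftm (fun n => e n) (ulift0 (fun n => f n) x).
Proof.
move=> fd; elim/two_step_ind: m x => [||m IH] x; [exact: fd | exact: fd |].
by apply: injective_projections; [exact: fd | exact: IH].
Qed.

Lemma uliftm_uliftp (d : forall n, {linear N n.+1 -> N n})
    (P : forall n, {linear M n -> N n.+1}) m (x : natl M m) :
  uliftm (fun n => d n) (uliftp (fun n => P n) x) =
    ulift0 (fun n y => d n (P n y)) x.
Proof.
elim/two_step_ind: m x => [||m IH] x //.
by apply: injective_projections; last exact: IH.
Qed.

(** [comp_low] on C^nat_m is [comp_low] on each coefficient: the coefficient in
degree 0 is dropped by [uliftm] and comes back as 0 from [uliftp]. *)
Lemma comp_low_ulift (P : forall n, {linear M n -> N n.+1})
    (d : forall n, {linear M n.+1 -> M n}) m (x : natl M m) :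
  ((fun n => uliftp (fun n => P n) (m := n)) \o-
     (fun n => uliftm (fun n => d n) (m := n))) m x =
    ulift0 (comp_low (fun n => P n) (fun n => d n)) x.
Proof.
elim/two_step_ind: m x => [||m IH] x //.
case: m IH x => [|[|m]] IH x //;
  by apply: injective_projections => //; exact: (IH x.2).
Qed.

End Relations.

Lemma seqprodP (k : pzRingType) (V : nat -> lmodType k) (x y : seqprod V) :
  (forall m, x m = y m) -> x = y.
Proof. exact: functional_extensionality_dep. Qed.

(** * Graded operators on the product of all degrees *)

Section GradedOperators.

Variables (k : pzRingType) (V W : nat -> lmodType k).

Definition deg0 (A : forall m, {linear V m -> W m}) :
  {linear seqprod V -> seqprod W}.
Proof.
apply: (@mkLin k (seqprod V) (seqprod W) (fun x m => A m (x m))) => a x y.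
by apply: seqprodP => m; exact: linearP.
Defined.

Definition deg_up (A : forall m, {linear V m -> W m.+1}) :
  {linear seqprod V -> seqprod W}.
Proof.
apply: (@mkLin k (seqprod V) (seqprod W)
  (fun x m => if m is m'.+1 then A m' (x m') else 0)) => a x y.
apply: seqprodP => -[|m]; last exact: linearP.
by rewrite -[RHS]/(a *: 0 + 0) scaler0 addr0.
Defined.

Definition deg_down (A : forall m, {linear V m.+1 -> W m}) :
  {linear seqprod V -> seqprod W}.
Proof.
apply: (@mkLin k (seqprod V) (seqprod W) (fun x m => A m (x m.+1))) => a x y.
by apply: seqprodP => m; exact: linearP.
Defined.

End GradedOperators.

Definition shift (k : pzRingType) (M : nat -> lmodType k) :
    {linear seqprod (natl M) -> seqprod (natl M)} :=
  @mkLin k (seqprod (natl M)) (seqprod (natl M)) (fun x m => nat_S (x m.+2))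
    (fun a x y => erefl).

(** Identities on the product specialize to degree m through the elements
concentrated in that degree. *)
Definition single (k : pzRingType) (V : nat -> lmodType k) m (x : V m) :
  seqprod V := @dfwith nat V (fun=> 0) m x.

Lemma singleE (k : pzRingType) (V : nat -> lmodType k) m (x : V m) :
  single x m = x.
Proof. exact: dfwith_in. Qed.

Section Lifts.

Variables (k : pzRingType) (M N : nat -> lmodType k).

Definition lift0 (A : forall m, {linear M m -> N m}) m :=
  mkLin (ulift0_linear A (m := m)).
Definition liftp (A : forall m, {linear M m -> N m.+1}) m :=
  mkLin (uliftp_linear A (m := m)).
Definition liftm (A : forall m, {linear M m.+1 -> N m}) m :=
  mkLin (uliftm_linear A (m := m)).
Definition series (A : forall j m, {linear M m -> N (j.*2 + m)%N}) m :=
  mkLin (u_series_linear A (m := m)).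

End Lifts.

(** * Geometric series of P Q u^-1 *)

Section Geometric.

Variables (k : pzRingType) (M : nat -> lmodType k).
Variables (P Q : forall n, {linear M n -> M n.+1}).
(* A j stands for (P Q)^j, with values in the degrees that [op_u] expects. *)
Variable (A : forall j n, {linear M n -> M (j.*2 + n)%N}).
Hypothesis A0 : forall n y, A 0 n y = y.
Hypothesis AS : forall j n y, A j.+1 n y = P _ (Q _ (A j n y)).

Let N : {linear seqprod (natl M) -> seqprod (natl M)} :=
  deg_up (liftp P) \o (deg_up (liftp Q) \o shift M).

Lemma op_u_iter j x m : iter j N x m = op_u (fun n => A j n) (x m).
Proof.
elim: j m => [|j IH] m.
  rewrite /=; elim/two_step_ind: m (x m) => [||m IH] y.
  - exact/esym/A0.
  - exact/esym/A0.
  - by apply: injective_projections; [exact/esym/A0 | exact: IH].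
case: m => [|[|m]]; first by []; first by rewrite /= linear0.
have stepE := op_u_step (A := fun j n y => A j n y) (x m.+2) (AS j).
by rewrite stepE /= IH.
Qed.

Lemma series_iter x m :
  deg0 (series A) x m = \sum_(j < m./2.+1) iter j N x m.
Proof. by apply: eq_bigr => j _; rewrite op_u_iter. Qed.

Lemma iter_eq0 x m : iter m./2.+1 N x m = 0.
Proof. by rewrite op_u_iter op_u_eq0. Qed.

Lemma N_series x m :
  N (deg0 (series A) x) m = \sum_(j < m./2.+1) iter j.+1 N x m.
Proof.
case: m => [|[|m]].
- by rewrite big1.
- by rewrite big1 /= ?linear0 // => i _; rewrite linear0.
transitivity (liftp P m.+1 (liftp Q m
  (mkLin (nat_S_linear (m := m)) (deg0 (series A) x m.+2)))) => //.
by rewrite series_iter !linear_sum.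
Qed.

(** The series is [sum_j N^j], truncated in degree m after [j = m / 2], and
[N^(m / 2 + 1) = 0] in that degree. *)
Lemma series_geometric : geometric_inverse N (deg0 (series A)).
Proof.
have split_sum x : deg0 (series A) x = x + N (deg0 (series A) x).
  apply: seqprodP => m; rewrite -[RHS]/(x m + _) N_series series_iter.
  rewrite big_ord_recl; congr (_ + _).
  by rewrite big_ord_recr [X in _ = _ + X]iter_eq0 addr0.
split=> // x; rewrite split_sum; congr (_ + _).
apply: seqprodP => m; rewrite N_series series_iter.
by apply: eq_bigr => j _; rewrite -iterSr.
Qed.

End Geometric.

(** * The total para-complex *)

Lemma deg_down_up (k : pzRingType) (M N : nat -> lmodType k)
    (d : forall n, {linear N n.+1 -> N n})
    (P : forall n, {linear M n -> N n.+1})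
    (x : seqprod (natl M)) m :
  deg_down (liftm d) (deg_up (liftp P) x) m =
    ulift0 (fun n y => d n (P n y)) (x m).
Proof. exact: uliftm_uliftp. Qed.

(** On the product of all degrees [comp_low] needs no separate treatment: in
degree 0 the operator of degree +1 already produces 0. *)
Lemma deg_up_down (k : pzRingType) (M N : nat -> lmodType k)
    (P : forall n, {linear M n -> N n.+1})
    (d : forall n, {linear M n.+1 -> M n})
    (x : seqprod (natl M)) m :
  deg_up (liftp P) (deg_down (liftm d) x) m =
    ulift0 (comp_low (fun n => P n) (fun n => d n)) (x m).
Proof. by rewrite -comp_low_ulift; case: m. Qed.

Section TotalPara.

Variables (k : pzRingType) (C : parachain k).

Lemma pc_T_linear m : linear (pc_T C m).
Proof.
move=> a x y; rewrite /pc_T /para_T !linearP /= scalerBr.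
have -> : (pc_B C \o- pc_b C) m (a *: x + y) =
    a *: (pc_B C \o- pc_b C) m x + (pc_B C \o- pc_b C) m y.
  by case: m x y => [|m] x y /=; rewrite ?scaler0 ?addr0 ?linearP.
by rewrite (addrACA (a *: _)) -scalerDr opprD addrACA.
Qed.

Definition tot_b := deg_down (liftm (pc_b C)).
Definition tot_B0 := deg_up (liftp (pc_B C)).
(** The operator [B u^-1], of degree -1. *)
Definition tot_B : {linear seqprod (natl C) -> seqprod (natl C)} :=
  tot_B0 \o shift C.
Definition tot_T := deg0 (lift0 (fun m => mkLin (pc_T_linear (m := m)))).

Lemma tot_BB0 x : tot_B0 (tot_B0 x) = 0.
Proof.
apply: seqprodP => -[|[|m]] //; first exact: linear0.
exact: (uliftp_uliftp_eq0 _ (@pc_BB k C)).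
Qed.

Lemma tot_shift_B0 x : shift C (tot_B0 x) = tot_B0 (shift C x).
Proof. by apply: seqprodP => -[|m]. Qed.

Lemma tot_shift_b x : shift C (tot_b x) = tot_b (shift C x).
Proof. by []. Qed.

Lemma tot_para x : tot_b (tot_B0 x) + tot_B0 (tot_b x) = x - tot_T x.
Proof.
apply: seqprodP => m.
rewrite -[LHS]/(_ m + _ m) deg_down_up deg_up_down.
transitivity (x m - ulift0 (pc_T C) (x m)) => //.
elim/two_step_ind: m (x m) => [||m IH] y /=.
- by rewrite /pc_T /para_T subKr.
- by rewrite /pc_T /para_T subKr.
- rewrite /pc_T.
  by apply: injective_projections; [rewrite /= /para_T subKr | exact: IH].
Qed.

(** [B T = B - B b B = T B], by [B^2 = 0]. *)
Lemma tot_T_B0 x : tot_T (tot_B0 x) = tot_B0 (tot_T x).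
Proof.
have TE y : tot_T y = y - (tot_b (tot_B0 y) + tot_B0 (tot_b y)).
  by rewrite tot_para subKr.
by rewrite !TE (linearB tot_B0) (linearD tot_B0) !tot_BB0 linear0 add0r addr0.
Qed.

Lemma tot_dE x m : (tot_b x + tot_B x) m = nat_d C m (x m.+1).
Proof. by case: m => [|m]; rewrite // -[LHS]/(_ + 0) addr0. Qed.

End TotalPara.

Arguments tot_b {k} C.
Arguments tot_B0 {k} C.
Arguments tot_B {k} C.
Arguments tot_T {k} C.

(** * The co-extensions f^nat, g^nat and phi^nat *)

Section Coextensions.

Variables (k : pzRingType) (C D : parachain k).
Variable (f : forall m, {linear C m -> D m}).
Variable (g : forall m, {linear D m -> C m}).
Variable (phi : forall m, {linear C m -> C m.+1}).
Hypothesis f_b : forall m (x : C m.+1), f m (pc_b C m x) = pc_b D m (f m.+1 x).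
Hypothesis g_b : forall m (x : D m.+1), g m (pc_b D m x) = pc_b C m (g m.+1 x).
Hypothesis fg : forall m (x : D m), f m (g m x) = x.
Hypothesis gf : forall m (x : C m),
       g m (f m x) = x + pc_b C m (phi m x) + (phi \o- pc_b C) m x.
Hypothesis f_T : forall m (x : C m), f m (pc_T C m x) = pc_T D m (f m x).
Hypothesis g_T : forall m (x : D m), g m (pc_T D m x) = pc_T C m (g m x).
Hypothesis phi_T : forall m (x : C m),
       phi m (pc_T C m x) = pc_T C m.+1 (phi m x).
Hypothesis f_phi : forall m (x : C m), f m.+1 (phi m x) = 0.
Hypothesis phi_g : forall m (x : D m), phi m (g m x) = 0.
Hypothesis phi_phi : forall m (x : C m), phi m.+1 (phi m x) = 0.
Hypothesis fBg : forall m (x : D m), f m.+1 (pc_B C m (g m x)) = pc_B D m x.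
Hypothesis fBphiBg : forall j, (1 <= j)%N -> forall m (x : D m),
       f (j.*2 + m.+1)%N (pow_Bphi phi j (pc_B C m (g m x))) = 0.

Lemma pow_Bphi_linear j n : linear (@pow_Bphi k C phi j n).
Proof. by elim: j => [|j IH] a x y //=; rewrite IH !linearP. Qed.

Lemma pow_phiB_linear j n : linear (@pow_phiB k C phi j n).
Proof. by elim: j => [|j IH] a x y //=; rewrite IH !linearP. Qed.

Definition lin_Bphi j n := mkLin (pow_Bphi_linear j (n := n)).
Definition lin_phiB j n := mkLin (pow_phiB_linear j (n := n)).

Definition tot_f := deg0 (lift0 f).
Definition tot_g := deg0 (lift0 g).
Definition tot_phi := deg_up (liftp phi).
Definition tot_X := deg0 (series lin_Bphi).
Definition tot_Y := deg0 (series lin_phiB).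

Lemma tot_shift_phi x : shift C (tot_phi x) = tot_phi (shift C x).
Proof. by apply: seqprodP => -[|m]. Qed.

Lemma tot_T_phi x : tot_T C (tot_phi x) = tot_phi (tot_T C x).
Proof.
apply: seqprodP => -[|m]; first exact: linear0.
by apply: ulift0_uliftp => n y; rewrite /= phi_T.
Qed.

Lemma tot_X_inv : geometric_inverse (tot_B C \o tot_phi) tot_X.
Proof.
have [Xl Xr] := series_geometric (A := lin_Bphi) (P := pc_B C) (Q := phi)
  (fun n y => erefl) (fun j n y => erefl).
split=> x.
  transitivity (x + tot_X (tot_B0 C (tot_phi (shift C x)))); first exact: Xl.
  by rewrite -tot_shift_phi.
transitivity (x + tot_B0 C (tot_phi (shift C (tot_X x)))); first exact: Xr.
by rewrite -tot_shift_phi.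
Qed.

Lemma tot_Y_inv : geometric_inverse (tot_phi \o tot_B C) tot_Y.
Proof.
exact: (series_geometric (A := lin_phiB) (P := phi) (Q := pc_B C)
  (fun n y => erefl) (fun j n y => erefl)).
Qed.

Lemma f_natE x m : f_nat f phi (x m) = tot_f (tot_X x) m.
Proof.
rewrite /= /f_nat /u_series -[RHS]/(lift0 f m _) linear_sum.
by apply: eq_bigr => j _; rewrite /= ulift0_op_u.
Qed.

Lemma g_natE x m : g_nat g phi (x m) = tot_Y (tot_g x) m.
Proof.
rewrite /= /g_nat /u_series.
by apply: eq_bigr => j _; rewrite /= op_u_ulift0.
Qed.

Lemma phi_natE x m : phi_nat phi (x m) = tot_phi (tot_X x) m.+1.
Proof. by rewrite -[RHS]/(liftp phi m _) linear_sum. Qed.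

Definition lin_fBphi j n : {linear C n -> D (j.*2 + n)%N} :=
  f _ \o lin_Bphi j n.
Definition lin_phiBg j n : {linear D n -> C (j.*2 + n)%N} :=
  lin_phiB j n \o g n.

Lemma f_nat_linear m : linear (@f_nat k C D f phi m).
Proof. exact: (u_series_linear lin_fBphi). Qed.

Lemma g_nat_linear m : linear (@g_nat k C D g phi m).
Proof. exact: (u_series_linear lin_phiBg). Qed.

(** Only the term [j = 0] of [f^nat] survives on the image of [B g]. *)
Lemma f_nat_Bg m (y : natl D m) :
  f_nat f phi (uliftp (fun n => pc_B C n) (ulift0 (fun n => g n) y)) =
    uliftp (fun n => pc_B D n) y.
Proof.
have BgE : uliftp (fun n => pc_B C n) (ulift0 (fun n => g n) y) =
    uliftp (fun n => pc_B C n \o g n) y by exact: uliftp_ulift0.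
rewrite BgE /f_nat /u_series big_ord_recl big1 => [|j _]; last first.
  by apply: (op_u_uliftp_eq0 (A := lin_fBphi j.+1)) => n z; exact: fBphiBg.
rewrite addr0; elim/two_step_ind: m y {BgE} => [||m IH] y.
- exact: fBg.
- by apply: injective_projections; [exact: fBg | exact: linear0].
- by apply: injective_projections; [exact: fBg | exact: IH].
Qed.

Lemma tot_fXBg x : tot_f (tot_X (tot_B C (tot_g x))) = tot_B D x.
Proof.
apply: seqprodP => -[|m]; rewrite -f_natE.
  exact: (linear0 (mkLin (@f_nat_linear 0))).
exact: f_nat_Bg.
Qed.

(* The curvature b B u^-1 + B u^-1 b = u^-1 (1 - T). *)
Let R : {linear seqprod (natl C) -> seqprod (natl C)} :=
  shift C \- (shift C \o tot_T C).

Lemma tot_perturbation :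
  [/\ forall x, tot_f (tot_X (tot_b C x + tot_B C x)) =
        tot_b D (tot_f (tot_X x)) + tot_B D (tot_f (tot_X x)),
      forall x, tot_Y (tot_g (tot_b D x + tot_B D x)) =
        tot_b C (tot_Y (tot_g x)) + tot_B C (tot_Y (tot_g x)),
      forall x, tot_f (tot_X (tot_Y (tot_g x))) = x
    & forall x, tot_Y (tot_g (tot_f (tot_X x))) =
        x + (tot_b C (tot_phi (tot_X x)) + tot_B C (tot_phi (tot_X x)))
          + tot_phi (tot_X (tot_b C x + tot_B C x))] /\ 
  [/\ forall x, tot_f (tot_X (tot_phi (tot_X x))) = 0,
      forall x, tot_phi (tot_X (tot_Y (tot_g x))) = 0
    & forall x, tot_phi (tot_X (tot_phi (tot_X x))) = 0].
Proof.
apply: (perturbation_lemma (R := R)).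
- move=> x; apply: seqprodP => m; exact: (ulift0_uliftm _ f_b).
- move=> x; apply: seqprodP => m; exact: (ulift0_uliftm _ g_b).
- move=> x; apply: seqprodP => m.
  rewrite /=; elim/two_step_ind: m (x m) => [||m IH] y; try exact: fg.
  by apply: injective_projections; [exact: fg | exact: IH].
- move=> x; apply: seqprodP => m.
  rewrite -[RHS]/(_ m + _ m + _ m) deg_down_up deg_up_down /=.
  elim/two_step_ind: m (x m) => [||m IH] y; [exact: gf | exact: gf |].
  by apply: injective_projections; [exact: gf | exact: IH].
- move=> x; apply: seqprodP => -[|m]; first exact: linear0.
  exact: (ulift0_uliftp_eq0 _ f_phi).
- move=> x; apply: seqprodP => -[|m] //.
  rewrite -[LHS]/(uliftp (fun n => phi n) (ulift0 (fun n => g n) (x m))).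
  rewrite uliftp_ulift0; elim/two_step_ind: m (x m) => [||m IH] y.
  + exact: phi_g.
  + by apply: injective_projections; first exact: phi_g.
  + by apply: injective_projections; [exact: phi_g | exact: IH].
- move=> x; apply: seqprodP => -[|[|m]] //; first exact: linear0.
  exact: (uliftp_uliftp_eq0 _ phi_phi).
- by move=> x; rewrite -[LHS]/(tot_B0 C _) tot_shift_B0 tot_BB0.
- move=> x.
  rewrite -[LHS]/(tot_b C (tot_B0 C (shift C x)) +
    tot_B0 C (shift C (tot_b C x))).
  by rewrite tot_shift_b tot_para.
- move=> x.
  rewrite -[LHS]/(shift C (tot_phi x) - shift C (tot_T C (tot_phi x))).
  by rewrite tot_T_phi !tot_shift_phi -linearB.
- exact: tot_X_inv.
- exact: tot_Y_inv.
- exact: tot_fXBg.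
Qed.

Lemma tot_shift_X x : shift C (tot_X x) = tot_X (shift C x).
Proof.
apply: (geometric_inverse_comm (N := tot_B C \o tot_phi)).
  exact: tot_X_inv.
move=> y; rewrite -[LHS]/(shift C (tot_B0 C (shift C (tot_phi y)))).
by rewrite tot_shift_B0 tot_shift_phi.
Qed.

Lemma tot_shift_Y x : shift C (tot_Y x) = tot_Y (shift C x).
Proof.
apply: (geometric_inverse_comm (N := tot_phi \o tot_B C)).
  exact: tot_Y_inv.
move=> y; rewrite -[LHS]/(shift C (tot_phi (tot_B0 C (shift C y)))).
by rewrite tot_shift_phi tot_shift_B0.
Qed.

Lemma tot_T_X x : tot_T C (tot_X x) = tot_X (tot_T C x).
Proof.
apply: (geometric_inverse_comm (N := tot_B C \o tot_phi)).
  exact: tot_X_inv.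
move=> y; rewrite -[LHS]/(tot_T C (tot_B0 C (shift C (tot_phi y)))).
by rewrite tot_T_B0 -[tot_T C (shift C _)]/(shift C (tot_T C _)) tot_T_phi.
Qed.

Lemma tot_T_Y x : tot_T C (tot_Y x) = tot_Y (tot_T C x).
Proof.
apply: (geometric_inverse_comm (N := tot_phi \o tot_B C)).
  exact: tot_Y_inv.
move=> y; rewrite -[LHS]/(tot_T C (tot_phi (tot_B0 C (shift C y)))).
by rewrite tot_T_phi tot_T_B0.
Qed.

Lemma lift0_T (L L' : parachain k) (h : forall m, {linear L m -> L' m}) m
    (x : natl L m) :
  (forall m (x : L m), h m (pc_T L m x) = pc_T L' m (h m x)) ->
  lift0 h m (nat_T L m x) = nat_T L' m (lift0 h m x).
Proof.
move=> h_T; elim/two_step_ind: m x => [||m IH] x; [exact: h_T | exact: h_T |].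
by apply: injective_projections; [exact: h_T | exact: IH].
Qed.

Lemma f_nat_S_map : S_map (f_nat f phi).
Proof.
have [[f_d _ _ _] _] := tot_perturbation.
split=> [|m x|m x|m x]; first exact: f_nat_linear.
- rewrite -{1}(singleE x) -tot_dE f_natE f_d tot_dE -f_natE.
  by rewrite singleE.
- rewrite -{1}(singleE x) -[nat_S _]/(shift C (single x) m) f_natE -tot_shift_X.
  by rewrite -[LHS]/(nat_S (tot_f (tot_X (single x)) m.+2)) -f_natE singleE.
- rewrite -{1}(singleE x) -[nat_T _ _ _]/(tot_T C (single x) m) f_natE -tot_T_X.
  rewrite -[LHS]/(lift0 f m (nat_T C m (tot_X (single x) m))) (lift0_T _ f_T).
  by rewrite -[lift0 f m _]/(tot_f (tot_X (single x)) m) -f_natE singleE.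
Qed.

Lemma g_nat_S_map : S_map (g_nat g phi).
Proof.
have [[_ g_d _ _] _] := tot_perturbation.
split=> [|m x|m x|m x]; first exact: g_nat_linear.
- rewrite -{1}(singleE x) -tot_dE g_natE g_d tot_dE -g_natE.
  by rewrite singleE.
- rewrite -{1}(singleE x) -[nat_S _]/(shift D (single x) m) g_natE.
  rewrite -[tot_g (shift D _)]/(shift C (tot_g _)) -tot_shift_Y.
  by rewrite -[LHS]/(nat_S (tot_Y (tot_g (single x)) m.+2)) -g_natE singleE.
- rewrite -{1}(singleE x) -[nat_T _ _ _]/(tot_T D (single x) m) g_natE.
  have -> : tot_g (tot_T D (single x)) = tot_T C (tot_g (single x)).
    by apply: seqprodP => n; exact: (lift0_T _ g_T).
  rewrite -tot_T_Y.
  by rewrite -[LHS]/(nat_T C m (tot_Y (tot_g (single x)) m)) -g_natE singleE.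
Qed.

Lemma f_nat_coextension : coextension f (f_nat f phi).
Proof. by split; [exact: f_nat_S_map | exists lin_fBphi]. Qed.

Lemma g_nat_coextension : coextension g (g_nat g phi).
Proof. by split; [exact: g_nat_S_map | exists lin_phiBg]. Qed.

Lemma phi_nat_linear m : linear (@phi_nat k C phi m).
Proof.
move=> a x y.
have phiE z : phi_nat phi z = liftp phi m (series lin_Bphi m z).
  by rewrite linear_sum.
by rewrite !phiE !linearP.
Qed.

Lemma nat_S_phi_nat1 (x : natl C 1) : nat_S (phi_nat phi x) = 0.
Proof. by rewrite /phi_nat big_ord1. Qed.

Lemma nat_S_phi_nat m (x : natl C m.+2) :
  phi_nat phi (nat_S x) = nat_S (phi_nat phi x).
Proof.
rewrite -{1}(singleE x) -[nat_S _]/(shift C (single x) m) phi_natE -tot_shift_X.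
rewrite -tot_shift_phi.
by rewrite -[LHS]/(nat_S (tot_phi (tot_X (single x)) m.+3)) -phi_natE singleE.
Qed.

Lemma nat_T_phi_nat m (x : natl C m) :
  phi_nat phi (nat_T C m x) = nat_T C m.+1 (phi_nat phi x).
Proof.
rewrite -{1}(singleE x) -[nat_T _ _ _]/(tot_T C (single x) m) phi_natE -tot_T_X.
rewrite -tot_T_phi.
rewrite -[LHS]/(nat_T C m.+1 (tot_phi (tot_X (single x)) m.+1)).
by rewrite -phi_natE singleE.
Qed.

Lemma f_nat_g_nat m (x : natl D m) : f_nat f phi (g_nat g phi x) = x.
Proof.
have [[_ _ fgE _] _] := tot_perturbation.
by rewrite -{1}(singleE x) g_natE f_natE fgE singleE.
Qed.

Lemma g_nat_f_nat m (x : natl C m) :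
  g_nat g phi (f_nat f phi x)
    = x + nat_d C m (phi_nat phi x) + (phi_nat phi \o- nat_d C) m x.
Proof.
have [[_ _ _ gfE] _] := tot_perturbation.
rewrite -{1}(singleE x) f_natE g_natE gfE -[LHS]/(_ m + _ m + _ m).
rewrite tot_dE -phi_natE singleE; congr (_ + _).
by case: m x => [|m] x //; rewrite -phi_natE tot_dE singleE.
Qed.

Lemma nat_special :
  (forall m (x : natl C m), f_nat f phi (phi_nat phi x) = 0) /\
  (forall m (x : natl D m), phi_nat phi (g_nat g phi x) = 0) /\
  (forall m (x : natl C m), phi_nat phi (phi_nat phi x) = 0).
Proof.
have [_ [f_phi0 phi_g0 phi_phi0]] := tot_perturbation.
split; last split; move=> m x; rewrite -(singleE x).
- by rewrite phi_natE f_natE f_phi0.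
- by rewrite g_natE phi_natE phi_g0.
- by rewrite !phi_natE phi_phi0.
Qed.

Lemma nat_retract :
  S_deformation_retract (f_nat f phi) (g_nat g phi) (phi_nat phi).
Proof.
split; [exact: f_nat_S_map | exact: g_nat_S_map | |
  exact: f_nat_g_nat | exact: g_nat_f_nat].
split; [exact: phi_nat_linear | exact: nat_S_phi_nat | exact: nat_S_phi_nat1 |
  exact: nat_T_phi_nat].
Qed.

End Coextensions.

(** * Passage to the periodic complexes *)

Section Truncation.

Variables (k : pzRingType) (M N : nat -> lmodType k).

Lemma coef0_trunc0 (x : sharp0 M) q : coef0 (trunc0 x q) = x q.
Proof. by case: q. Qed.

Lemma coef0_trunc1 (x : sharp1 M) q : coef0 (trunc1 x q) = x q.
Proof. by case: q. Qed.

Lemma trunc0_inj (x y : sharp0 M) :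
  (forall q, trunc0 x q = trunc0 y q) -> x = y.
Proof. by move=> xy; apply: seqprodP => q; rewrite -!coef0_trunc0 xy. Qed.

Lemma trunc1_inj (x y : sharp1 M) :
  (forall q, trunc1 x q = trunc1 y q) -> x = y.
Proof. by move=> xy; apply: seqprodP => q; rewrite -!coef0_trunc1 xy. Qed.

(** The truncations are the projections of an inverse limit, so equalities in
C^sharp can be checked on them. *)
Lemma sharp_inj (z w : sharp M) :
  (forall q, trunc0 z.1 q = trunc0 w.1 q) ->
  (forall q, trunc1 z.2 q = trunc1 w.2 q) -> z = w.
Proof.
by move=> /trunc0_inj E0 /trunc1_inj E1; apply: injective_projections.
Qed.

Lemma trunc0_linear q : linear (fun x : sharp0 M => trunc0 x q).
Proof. by move=> a x y; elim: q => [|q /= ->]. Qed.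

Lemma trunc1_linear q : linear (fun x : sharp1 M => trunc1 x q).
Proof. by move=> a x y; elim: q => [|q /= ->]. Qed.

Lemma trunc0D (z w : sharp M) q :
  trunc0 (z + w).1 q = trunc0 z.1 q + trunc0 w.1 q.
Proof. exact: (linearD (mkLin (trunc0_linear q))). Qed.

Lemma trunc1D (z w : sharp M) q :
  trunc1 (z + w).2 q = trunc1 z.2 q + trunc1 w.2 q.
Proof. exact: (linearD (mkLin (trunc1_linear q))). Qed.

Lemma trunc0_sharp_map (F : forall m, natl M m -> natl N m) (z : sharp M) q :
  (forall m x, F m (nat_S x) = nat_S (F m.+2 x)) ->
  trunc0 (sharp_map F z).1 q = F q.*2 (trunc0 z.1 q).
Proof.
move=> F_S; elim: q => [|q IH] //.
by apply: injective_projections => //; rewrite /= IH -[RHS]F_S.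
Qed.

Lemma trunc1_sharp_map (F : forall m, natl M m -> natl N m) (z : sharp M) q :
  (forall m x, F m (nat_S x) = nat_S (F m.+2 x)) ->
  trunc1 (sharp_map F z).2 q = F q.*2.+1 (trunc1 z.2 q).
Proof.
move=> F_S; elim: q => [|q IH] //.
by apply: injective_projections => //; rewrite /= IH -[RHS]F_S.
Qed.

(** The vanishing of [S H] on C^nat_1 makes the lowest coefficients agree. *)
Lemma trunc0_sharp_map1 (H : forall m, natl M m -> natl N m.+1)
    (z : sharp M) q :
  (forall m x, H m (nat_S x) = nat_S (H m.+2 x)) ->
  (forall x, nat_S (H 1%N x) = 0) ->
  trunc0 (sharp_map1 H z).1 q.+1 = H q.*2.+1 (trunc1 z.2 q).
Proof.
move=> H_S H_S1; elim: q => [|q IH].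
  by apply: injective_projections => //; exact/esym/H_S1.
by apply: injective_projections => //; rewrite [LHS]IH -[RHS]H_S.
Qed.

Lemma trunc1_sharp_map1 (H : forall m, natl M m -> natl N m.+1)
    (z : sharp M) q :
  (forall m x, H m (nat_S x) = nat_S (H m.+2 x)) ->
  trunc1 (sharp_map1 H z).2 q = H q.*2 (trunc0 z.1 q).
Proof.
move=> H_S; elim: q => [|q IH] //.
by apply: injective_projections => //; rewrite /= IH -[RHS]H_S.
Qed.

End Truncation.

Section SharpComplex.

Variables (k : pzRingType) (C : parachain k).

Lemma nat_S_d m (x : natl C m.+3) :
  nat_S (nat_d C m.+2 x) = nat_d C m (nat_S x).
Proof.
case: m x => [|m] x //.
by rewrite -[LHS]/(_ + 0) addr0.
Qed.

Lemma trunc0_sharp_d (z : sharp C) q :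
  trunc0 (sharp_d z).1 q = nat_d C q.*2 (trunc1 z.2 q).
Proof.
elim: q => [|q IH] //.
apply: injective_projections; last first.
  exact: (etrans IH (esym (nat_S_d (trunc1 z.2 q.+1)))).
by case: q {IH} => [|q].
Qed.

Lemma trunc1_sharp_d (z : sharp C) q :
  trunc1 (sharp_d z).2 q = nat_d C q.*2.+1 (trunc0 z.1 q.+1).
Proof.
elim: q => [|q IH] //.
apply: injective_projections; first by [].
exact: (etrans IH (esym (nat_S_d (trunc0 z.1 q.+2)))).
Qed.

Lemma trunc0_sharp_T (z : sharp C) q :
  trunc0 (sharp_T z).1 q = nat_T C q.*2 (trunc0 z.1 q).
Proof.
by elim: q => [|q IH] //; apply: injective_projections; last exact: IH.
Qed.

Lemma trunc1_sharp_T (z : sharp C) q :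
  trunc1 (sharp_T z).2 q = nat_T C q.*2.+1 (trunc1 z.2 q).
Proof.
by elim: q => [|q IH] //; apply: injective_projections; last exact: IH.
Qed.

End SharpComplex.

Lemma linear_map0 (k : pzRingType) (U V : lmodType k) (h : U -> V) :
  linear h -> h 0 = 0.
Proof. by move=> lin_h; exact: (linear0 (mkLin lin_h)). Qed.

Lemma coef0_0 (k : pzRingType) (M : nat -> lmodType k) m :
  coef0 (0 : natl M m) = 0.
Proof. exact/linear_map0/coef0_linear. Qed.

Lemma sharp_map_T_map (k : pzRingType) (C D : parachain k)
    (F : forall m, natl C m -> natl D m) :
  S_map F -> T_map (sharp_map F).
Proof.
move=> [F_lin F_d F_S F_T]; split=> [a x y||z|z].
- apply: injective_projections; apply: seqprodP => q.
    by rewrite /= trunc0_linear F_lin coef0_linear.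
  rewrite -[LHS]/(coef0 (F _ (trunc1 (a *: x.2 + y.2) q))) trunc1_linear F_lin.
  exact: coef0_linear.
- split=> x; apply: seqprodP => q.
    rewrite -[LHS]/(coef0 (F _ (trunc1 0 q))) (linear_map0 (trunc1_linear _)).
    by rewrite (linear_map0 (F_lin _)) coef0_0.
  rewrite -[LHS]/(coef0 (F _ (trunc0 0 q))) (linear_map0 (trunc0_linear _)).
  by rewrite (linear_map0 (F_lin _)) coef0_0.
- apply: sharp_inj => q.
    by rewrite trunc0_sharp_map // !trunc0_sharp_d trunc1_sharp_map.
  by rewrite trunc1_sharp_map // !trunc1_sharp_d trunc0_sharp_map.
- apply: sharp_inj => q.
    by rewrite trunc0_sharp_map // !trunc0_sharp_T trunc0_sharp_map.
  by rewrite trunc1_sharp_map // !trunc1_sharp_T trunc1_sharp_map.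
Qed.

(** Every identity holds after each truncation, where it is the corresponding
identity in C^nat. *)
Theorem sharp_retract (k : pzRingType) (C D : parachain k)
    (F : forall m, natl C m -> natl D m) (G : forall m, natl D m -> natl C m)
    (H : forall m, natl C m -> natl C m.+1) :
  S_deformation_retract F G H ->
  T_deformation_retract (sharp_map F) (sharp_map G) (sharp_map1 H).
Proof.
move=> [F_S_map G_S_map [H_lin H_S H_S1 H_T] FG GF].
have [_ _ F_S _] := F_S_map; have [_ _ G_S _] := G_S_map.
split; [exact: sharp_map_T_map | exact: sharp_map_T_map | | |].
- split=> [a x y||z].
  + apply: injective_projections; apply: seqprodP => q.
      case: q => [|q]; first by rewrite -[RHS]/(a *: 0 + 0) scaler0 addr0.
      rewrite -[LHS]/(coef0 (H _ (trunc1 (a *: x.2 + y.2) q))).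
      by rewrite trunc1_linear H_lin coef0_linear.
    rewrite -[LHS]/(coef0 (H _ (trunc0 (a *: x.1 + y.1) q))).
    by rewrite trunc0_linear H_lin coef0_linear.
  + split=> x; apply: seqprodP => q.
      case: q => [|q] //; rewrite -[LHS]/(coef0 (H _ (trunc1 0 q))).
      rewrite (linear_map0 (trunc1_linear _)) (linear_map0 (H_lin _)).
      exact: coef0_0.
    rewrite -[LHS]/(coef0 (H _ (trunc0 0 q))).
    by rewrite (linear_map0 (trunc0_linear _)) (linear_map0 (H_lin _)) coef0_0.
  + apply: sharp_inj => q.
      case: q => [|q].
        by rewrite trunc0_sharp_T; exact/esym/linear_map0/pc_T_linear.
      rewrite trunc0_sharp_map1 // trunc0_sharp_T trunc0_sharp_map1 //.
      by rewrite trunc1_sharp_T H_T.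
    rewrite trunc1_sharp_map1 // !trunc0_sharp_T trunc1_sharp_T.
    by rewrite trunc1_sharp_map1.
- move=> z; apply: sharp_inj => q.
    by rewrite !trunc0_sharp_map // FG.
  by rewrite !trunc1_sharp_map // FG.
- move=> z; apply: sharp_inj => q.
    rewrite !trunc0_sharp_map // GF !trunc0D.
    rewrite trunc0_sharp_d trunc1_sharp_map1 //; congr (_ + _).
    case: q => [|q] //.
    by rewrite (trunc0_sharp_map1 _ _ H_S H_S1) trunc1_sharp_d.
  rewrite !trunc1_sharp_map // GF !trunc1D.
  rewrite trunc1_sharp_d trunc0_sharp_map1 //; congr (_ + _).
  by rewrite trunc1_sharp_map1 // trunc0_sharp_d.
Qed.

Theorem lemma7p13 (k : pzRingType) (C D : parachain k)
    (f : forall m, {linear C m -> D m})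
    (g : forall m, {linear D m -> C m})
    (phi : forall m, {linear C m -> C m.+1})
    (f_b : forall m (x : C m.+1), f m (pc_b C m x) = pc_b D m (f m.+1 x))
    (g_b : forall m (x : D m.+1), g m (pc_b D m x) = pc_b C m (g m.+1 x))
    (fg : forall m (x : D m), f m (g m x) = x)
    (gf : forall m (x : C m),
       g m (f m x) = x + pc_b C m (phi m x) + (phi \o- pc_b C) m x)
    (f_T : forall m (x : C m), f m (pc_T C m x) = pc_T D m (f m x))
    (g_T : forall m (x : D m), g m (pc_T D m x) = pc_T C m (g m x))
    (phi_T : forall m (x : C m),
       phi m (pc_T C m x) = pc_T C m.+1 (phi m x))
    (f_phi : forall m (x : C m), f m.+1 (phi m x) = 0)
    (phi_g : forall m (x : D m), phi m (g m x) = 0)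
    (phi_phi : forall m (x : C m), phi m.+1 (phi m x) = 0)
    (fBg : forall m (x : D m), f m.+1 (pc_B C m (g m x)) = pc_B D m x)
    (fBphiBg : forall j, (1 <= j)%N -> forall m (x : D m),
       f (j.*2 + m.+1)%N (pow_Bphi phi j (pc_B C m (g m x))) = 0) :
  (S_map (f_nat f phi) /\ S_map (g_nat g phi) /\
   coextension f (f_nat f phi) /\ coextension g (g_nat g phi)) /\
  ((forall m (x : natl D m), f_nat f phi (g_nat g phi x) = x) /\
   (forall m (x : natl C m),
      g_nat g phi (f_nat f phi x)
        = x + nat_d C m (phi_nat phi x) + (phi_nat phi \o- nat_d C) m x) /\
   S_deformation_retract (f_nat f phi) (g_nat g phi) (phi_nat phi) /\
   T_deformation_retract (sharp_map (f_nat f phi)) (sharp_map (g_nat g phi))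
     (sharp_map1 (phi_nat phi))) /\
  ((forall m (x : natl C m), f_nat f phi (phi_nat phi x) = 0) /\
   (forall m (x : natl D m), phi_nat phi (g_nat g phi x) = 0) /\
   (forall m (x : natl C m), phi_nat phi (phi_nat phi x) = 0)).
Proof.
have f_S := f_nat_S_map f_b g_b fg gf f_T phi_T f_phi phi_g phi_phi fBg fBphiBg.
have retract :=
  nat_retract f_b g_b fg gf f_T g_T phi_T f_phi phi_g phi_phi fBg fBphiBg.
have [_ g_S _ fgE gfE] := retract.
split; last split.
- split=> //; split=> //.
  by split; [exact: f_nat_coextension | exact: g_nat_coextension].
- by do 3?split => //; exact: sharp_retract.
- exact: (nat_special f_b g_b fg gf phi_T f_phi phi_g phi_phi fBg fBphiBg).
Qed.
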